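(* Let $n\ge 4$ be an integer and let $K$ be the Markov kernel of the simple random walk on $\mathbb{Z}_n$: $K(x,y)=\frac12$ if $y=x\pm1$ (modulo $n$) and $K(x,y)=0$ otherwise. Then for every $f:\mathbb{Z}_n\to[0,\infty)$, $$\int_{\mathbb{Z}_n} f^2\log f^2\,d\mu_n-\|f\|_2^2\log\|f\|_2^2\le \frac{2}{1-\cos(\frac{2\pi}{n})}\,\langle f,(I-K)f\rangle_{L_2(\mathbb{Z}_n,\mu_n)},$$ and the constant $\frac{2}{1-\cos(2\pi/n)}$ is optimal (the inequality for all such $f$ fails with any smaller constant in its place).
   Context: $\mathbb{Z}_n=\{0,1,\dots,n-1\}$ is the cyclic group with the normalized counting measure $\mu_n$ (each point has mass $1/n$); $\|f\|_2^2=\frac1n\sum_x|f(x)|^2$ and $\langle f,g\rangle_{L_2(\mathbb{Z}_n,\mu_n)}$ is the corresponding inner product. Convention: $0\log 0=0$. The kernel acts on functions by $(Kf)(x)=\sum_yK(x,y)f(y)=\frac12(f(x+1)+f(x-1))$. *)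

(* Defs.v *)
From HB Require Import structures.
From mathcomp Require Import all_boot all_order all_algebra.
From mathcomp Require Import all_classical all_reals all_analysis.

Set Implicit Arguments.
Unset Strict Implicit.
Unset Printing Implicit Defensive.

Import Order.TTheory GRing.Theory Num.Theory.
Local Open Scope ring_scope.

(* These definitions have the intended meaning only for 1 < n: ['Z_0] and
   ['Z_1] both denote Z/2. For n = 2 the steps x + 1 and x - 1 coincide, so
   [srw_kernel] is Markov only for 2 < n. *)
Section CycleWalk.
Variables (R : realType) (n : nat).
Implicit Types f g : 'Z_n -> R.

(* Integration against the uniform probability measure mu_n. *)
Definition mean f : R := n%:R^-1 * \sum_(x : 'Z_n) f x.

Definition inner f g : R := mean (fun x => f x * g x).

Definition norm2_sq f : R := mean (fun x => `|f x| ^+ 2).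

Definition srw_kernel (x y : 'Z_n) : R :=
  if (y == x + 1) || (y == x - 1) then 2^-1 else 0.

Definition kernel_act (K : 'Z_n -> 'Z_n -> R) f (x : 'Z_n) : R :=
  \sum_(y : 'Z_n) K x y * f y.

(* The convention 0 log 0 = 0 holds because of the factor in front of [ln]. *)
Definition entropy_sq f : R :=
  mean (fun x => f x ^+ 2 * ln (f x ^+ 2)) - norm2_sq f * ln (norm2_sq f).

Definition dirichlet (K : 'Z_n -> 'Z_n -> R) f : R :=
  inner f (fun x => f x - kernel_act K f x).

End CycleWalk.

Arguments srw_kernel : clear implicits.

(* Main.v *)
Require Import Defs.
From HB Require Import structures.
From mathcomp Require Import all_boot all_order all_algebra.
From mathcomp Require Import all_classical all_reals all_analysis.
From mathcomp Require Import ring lra zify.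

Set Implicit Arguments.
Unset Strict Implicit.
Unset Printing Implicit Defensive.

Import Order.TTheory GRing.Theory Num.Theory.
Import numFieldNormedType.Exports.
Local Open Scope classical_set_scope.
Local Open Scope ring_scope.

(** Normalize f to have L2-norm 1. The cubic Taylor polynomial of t^2 log t^2
    at 1 is an upper bound on [0, +oo[, so the entropy is at most a cubic
    expression in f. Writing f = a + g with a the mean of f and lambda for the
    spectral gap 1 - cos (2 pi / n), the claim reduces to
    [mean g^3 <= 3/4 (mean g^2)^2 + 3 (E(g) / lambda - mean g^2)]
    for g of mean 0 with [mean g^2 <= 1]. Split g = p + h, with p in the first
    eigenspace. The excess E(g) / lambda - mean g^2 only involves h, the mean
    of p^3 vanishes because n does not divide 3 (this is where n = 3 fails),
    p^2 correlates with h only through the modes 2 and n - 2, and the terms of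
    higher order in h are absorbed by the gap between the first and the second
    nonzero eigenvalue. For n = 4 the space of h is one-dimensional and these
    terms vanish.
    Optimality follows by expanding the entropy of 1 + e cos (2 pi x / n). *)

(** * Polynomial bounds for the entropy integrand *)

Lemma sqr_ln_le (R : realType) (t : R) : 0 <= t ->
  2 * t ^+ 2 * ln t <= 2 / 3 * t ^+ 3 + t ^+ 2 - 2 * t + 1 / 3.
Proof.
rewrite le_eqVlt => /predU1P[<-|t0]; first by rewrite !expr0n /=; lra.
(* The difference divided by t^2; its derivative has the sign of t - 1. *)
pose r : R -> R := (2 / 3) *: id + cst 1 - 2 *: (fun t : R => t^-1)
  + (1 / 3) *: ((fun t : R => t^-1) ^+ 2) - 2 *: @ln R.
have dr (x : R) : 0 < x -> is_derive x 1 r (2 / 3 * (x - 1) ^+ 3 / x ^+ 3).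
  move=> x0; have xn0 : x != 0 by rewrite gt_eqF.
  have h1 := is_derive1_ln x0.
  have h2 : is_derive x 1 (fun t : R => t^-1) (- x ^- 2).
    apply: is_derive_eq; first exact: is_deriveV.
    by rewrite /GRing.scale /= mulr1.
  by apply: is_derive_eq; rewrite /= /GRing.scale /=; field.
have cr (a b : R) : 0 < a -> {within `[a, b], continuous r}.
  move=> a0; apply: derivable_within_continuous => x.
  rewrite in_itv /= => /andP[ax _].
  by have [] := dr _ (lt_le_trans a0 ax).
have rE x : r x = 2 / 3 * x + 1 - 2 * x^-1 + 1 / 3 * x^-1 ^+ 2 - 2 * ln x.
  by [].
have r1 : r 1 = 0 by rewrite rE ln1; field.
have mvt := @MVT_segment R r (fun x => 2 / 3 * (x - 1) ^+ 3 / x ^+ 3).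
have r_ge0 : 0 <= r t.
  clearbody r; case: (lerP t 1) => t1.
  - have [x|c] := mvt t 1 t1 _ (cr _ _ t0).
      by rewrite in_itv /= => /andP[tx _]; apply: dr; apply: lt_trans tx.
    rewrite in_itv /= => /andP[tc c1]; rewrite r1 sub0r => /eqP.
    rewrite eqr_oppLR => /eqP ->.
    have -> : - (2 / 3 * (c - 1) ^+ 3 / c ^+ 3 * (1 - t)) =
      2 / 3 * (1 - c) ^+ 3 / c ^+ 3 * (1 - t) by ring.
    by rewrite !mulr_ge0 ?invr_ge0 ?exprn_ge0 ?subr_ge0 // (le_trans _ tc) // ltW.
  - have [x|c] := mvt 1 t (ltW t1) _ (cr _ _ ltr01).
      by rewrite in_itv /= => /andP[tx _]; apply: dr; apply: lt_trans tx.
    rewrite in_itv /= => /andP[c1 ct]; rewrite r1 subr0 => ->.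
    by rewrite !mulr_ge0 ?invr_ge0 ?exprn_ge0 ?subr_ge0 ?(ltW t1) // (le_trans _ c1).
have tn0 : t != 0 by rewrite gt_eqF.
rewrite -subr_ge0.
have -> : 2 / 3 * t ^+ 3 + t ^+ 2 - 2 * t + 1 / 3 - 2 * t ^+ 2 * ln t = t ^+ 2 * r t.
  by rewrite rE; field.
by rewrite mulr_ge0 ?sqr_ge0.
Qed.

(** This is [sqr_ln_le] at [1 / t], multiplied by [t^4]; it serves for optimality. *)
Lemma sqr_ln_ge (R : realType) (t : R) : 0 < t ->
  2 * t ^+ 3 - t ^+ 4 / 3 - t ^+ 2 - 2 / 3 * t <= 2 * t ^+ 2 * ln t.
Proof.
move=> t0; have tn0 : t != 0 by rewrite gt_eqF.
have := @sqr_ln_le R t^-1; rewrite invr_ge0 ltW // => /(_ isT).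
rewrite lnV // -(ler_pM2l (exprn_gt0 4 t0)).
have -> : t ^+ 4 * (2 * t^-1 ^+ 2 * - ln t) = - (2 * t ^+ 2 * ln t) by field.
have -> : t ^+ 4 * (2 / 3 * t^-1 ^+ 3 + t^-1 ^+ 2 - 2 / t + 1 / 3) =
  - (2 * t ^+ 3 - t ^+ 4 / 3 - t ^+ 2 - 2 / 3 * t) by field.
by rewrite lerN2.
Qed.

(** * Trigonometric sums and Fourier analysis on the cycle *)

Lemma sum_cos_sin_eq0 (R : realType) (n : nat) (t : R) :
  cos (n%:R * t) = 1 -> cos t != 1 ->
  (\sum_(k < n) cos (k%:R * t) = 0) * (\sum_(k < n) sin (k%:R * t) = 0).
Proof.
move=> cn1 ct1.
have sn0 : sin (n%:R * t) = 0 by apply: cos1sin0; rewrite cn1 normr1.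
(* The vector (C, S) is fixed by the rotation of angle t. *)
set C := \sum_(k < n) cos _; set S := \sum_(k < n) sin _.
have CE : C = \sum_(k < n) cos (k.+1%:R * t).
  apply: (addrI (cos (0%:R * t))); rewrite -(big_ord_recl _ (fun k => cos (k%:R * t))).
  by rewrite big_ord_recr /= addrC mul0r cos0 cn1.
have SE : S = \sum_(k < n) sin (k.+1%:R * t).
  apply: (addrI (sin (0%:R * t))); rewrite -(big_ord_recl _ (fun k => sin (k%:R * t))).
  by rewrite big_ord_recr /= addrC mul0r sin0 sn0.
have {}CE : C = cos t * C - sin t * S.
  rewrite {1}CE !mulr_sumr -sumrB; apply: eq_bigr => k _.
  by rewrite -natr1 mulrDl mul1r cosD mulrC [sin _ * _]mulrC.
have {}SE : S = sin t * C + cos t * S.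
  rewrite {1}SE !mulr_sumr -big_split; apply: eq_bigr => k _.
  by rewrite -natr1 mulrDl mul1r sinD addrC mulrC [sin _ * _]mulrC.
have ct0 : 1 - cos t != 0 by rewrite subr_eq0 eq_sym.
have e1 : (1 - cos t) * C = - (sin t * S) by move: CE; lra.
have e2 : (1 - cos t) * S = sin t * C by move: SE; lra.
(* Eliminating the other sum from [e1] and [e2] gives this premise;
   [(1 - cos t)^2 + sin^2 t = 2 (1 - cos t)] is nonzero, so [x] vanishes. *)
have key x : (1 - cos t) ^+ 2 * x = - (sin t ^+ 2 * x) -> x = 0.
  rewrite sin2cos2 => e; apply: (mulfI ct0); rewrite mulr0.
  by have : (1 - cos t) ^+ 2 * x + (1 - cos t ^+ 2) * x = 0; [rewrite e; lra|lra].
split; apply: key.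
  by rewrite expr2 -mulrA e1 mulrN mulrCA e2 expr2 mulrA.
by rewrite expr2 -mulrA e2 mulrCA e1 mulrN expr2 mulrA.
Qed.

Section Fourier.
Context {R : realType} (n : nat).
Implicit Types (f g : 'Z_n -> R) (j k : nat).

Definition cosn j : R := cos (j%:R * (2 * pi / n%:R)).
Definition sinn j : R := sin (j%:R * (2 * pi / n%:R)).

Lemma cosn0 : cosn 0 = 1. Proof. by rewrite /cosn mul0r cos0. Qed.
Lemma sinn0 : sinn 0 = 0. Proof. by rewrite /sinn mul0r sin0. Qed.

Lemma cosnD j k : cosn (j + k) = cosn j * cosn k - sinn j * sinn k.
Proof. by rewrite /cosn natrD mulrDl cosD. Qed.

Lemma sinnD j k : sinn (j + k) = sinn j * cosn k + cosn j * sinn k.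
Proof. by rewrite /sinn natrD mulrDl sinD. Qed.

Lemma cosn_sinn_sqr j : cosn j ^+ 2 + sinn j ^+ 2 = 1.
Proof. exact: cos2Dsin2. Qed.

Hypothesis n_gt1 : (1 < n)%N.

Let nR_neq0 : n%:R != 0 :> R. Proof. by rewrite pnatr_eq0 -lt0n ltnW. Qed.

Lemma cosn_period k : cosn (n * k) = 1.
Proof.
have -> : cosn (n * k) = cos (0 + (pi *+ 2) *+ k).
  by rewrite /cosn natrM -(mulr_natr (pi *+ 2)) -(mulr_natr pi); congr cos; field.
by rewrite (periodicn (@cosD2pi R)) cos0.
Qed.

Lemma sinn_period k : sinn (n * k) = 0.
Proof. by apply: cos1sin0; rewrite -/(cosn _) cosn_period normr1. Qed.

(** Up to full periods the angle is [2 pi d / n] with [0 < d < n], and one minus its cosine is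
    [2 sin^2 (pi d / n)]. *)
Lemma cosn_lt1 j : ~~ (n %| j)%N -> cosn j < 1.
Proof.
move=> nj; rewrite (divn_eq j n) addnC mulnC cosnD cosn_period sinn_period.
rewrite mulr1 mulr0 subr0.
have d0 : (0 < j %% n)%N by rewrite lt0n.
have dn : (j %% n < n)%N by rewrite ltn_mod ltnW.
move: (j %% n)%N d0 dn => d d0 dn.
have -> : cosn d = 1 - 2 * sin (d%:R * pi / n%:R) ^+ 2.
  rewrite sin2cos2 /cosn.
  have -> : d%:R * (2 * pi / n%:R) = (d%:R * pi / n%:R) *+ 2 :> R by field.
  by rewrite cos_mulr2n -mulr_natl; ring.
rewrite ltrBlDr ltrDl mulr_gt0 // exprn_gt0 // sin_gt0_pi //.
have n0 : 0 < n%:R :> R by rewrite ltr0n ltnW.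
apply/andP; split; first by rewrite divr_gt0 // mulr_gt0 ?ltr0n ?pi_gt0.
rewrite ltr_pdivrMr // mulrC ltr_pM2l ?pi_gt0 //.
by rewrite ltr_nat.
Qed.

Lemma sum_cosn_sinn j : ~~ (n %| j)%N ->
  (\sum_(k < n) cosn (k * j) = 0) * (\sum_(k < n) sinn (k * j) = 0).
Proof.
move=> nj; pose t : R := j%:R * (2 * pi / n%:R).
have nt : cos (n%:R * t) = 1 by rewrite /t mulrA -natrM; apply: cosn_period.
have t1 : cos t != 1 by rewrite lt_eqF // cosn_lt1.
have [c0 s0] := sum_cos_sin_eq0 nt t1.
split; [rewrite -[RHS]c0|rewrite -[RHS]s0];
  by apply: eq_bigr => k _; rewrite /cosn /sinn natrM -mulrA.
Qed.

Lemma sum_Zn (u : nat -> R) : \sum_(x : 'Z_n) u x = \sum_(k < n) u k.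
Proof. by case: n n_gt1 => [|[|m]]. Qed.

Lemma ltn_Zn (x : 'Z_n) : (x < n)%N.
Proof. by case: n n_gt1 x => [|[|m]] // _ x; apply: ltn_ord. Qed.

(** Each summand is the cosine of a difference of angles; ordering [x] and [y] keeps [x - y] a
    genuine natural number, not divisible by [n] unless it is 0. *)
Lemma sum_character (x y : 'Z_n) :
  \sum_(k < n) (cosn (k * x) * cosn (k * y) + sinn (k * x) * sinn (k * y)) =
  if x == y then n%:R else 0.
Proof.
wlog le_yx : x y / (y <= x)%N.
  move=> hw; case/orP: (leq_total y x) => [|/hw e]; first exact: hw.
  by rewrite eq_sym -e; apply: eq_bigr => k _; rewrite mulrC [sinn _ * _]mulrC.
have -> : \sum_(k < n) (cosn (k * x) * cosn (k * y) + sinn (k * x) * sinn (k * y)) =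
    \sum_(k < n) cosn (k * (x - y)).
  apply: eq_bigr => k _; rewrite /cosn /sinn -cosB -mulrBl.
  by rewrite -natrB ?mulnBr // leq_mul2l le_yx orbT.
case: eqVneq => [->|xy].
  under eq_bigr do rewrite subnn muln0 cosn0.
  by rewrite sumr_const card_ord.
rewrite sum_cosn_sinn //; apply/negP => /dvdn_leq; rewrite subn_gt0 ltn_neqAle le_yx andbT eq_sym.
move=> /(_ xy); rewrite leqNgt => /negP; apply.
exact: leq_ltn_trans (leq_subr _ _) (ltn_Zn x).
Qed.

Lemma meanD f g : mean (fun x => f x + g x) = mean f + mean g.
Proof. by rewrite /mean big_split mulrDr. Qed.

Lemma meanZ c f : mean (fun x => c * f x) = c * mean f.
Proof. by rewrite /mean -mulr_sumr mulrCA. Qed.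

Lemma eq_mean f g : f =1 g -> mean f = mean g.
Proof. by move=> fg; congr (_ * _); apply: eq_bigr => x _. Qed.

Lemma mean_cst c : mean (fun _ : 'Z_n => c) = c :> R.
Proof.
by rewrite /mean sumr_const card_ord Zp_cast // -[c *+ _]mulr_natl mulKf.
Qed.

Lemma mean_sum (I : finType) (P : pred I) (F : I -> 'Z_n -> R) :
  mean (fun x => \sum_(i | P i) F i x) = \sum_(i | P i) mean (F i).
Proof. by rewrite /mean exchange_big -mulr_sumr. Qed.

Lemma ler_mean f g : (forall x, f x <= g x) -> mean f <= mean g.
Proof. by move=> fg; rewrite ler_wpM2l ?invr_ge0 ?ler0n // ler_sum. Qed.

(** Real and, up to sign, imaginary parts of the Fourier coefficients. All [n] frequencies are kept,
    so [k] and [n - k] carry the same information and inversion has no factor 2. *)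
Definition coefc f k := mean (fun x => f x * cosn (k * x)).
Definition coefs f k := mean (fun x => f x * sinn (k * x)).

Lemma fourier_inversion f x :
  f x = \sum_(k < n) (coefc f k * cosn (k * x) + coefs f k * sinn (k * x)).
Proof.
have -> : \sum_(k < n) (coefc f k * cosn (k * x) + coefs f k * sinn (k * x)) =
  \sum_(k < n) mean (fun y => f y *
    (cosn (k * y) * cosn (k * x) + sinn (k * y) * sinn (k * x))).
  apply: eq_bigr => k _; rewrite mulrC [coefs _ _ * _]mulrC -!meanZ -meanD.
  by apply: eq_mean => y; ring.
rewrite -mean_sum (@eq_mean _ (fun y => f y * (if y == x then n%:R else 0))).
  rewrite /mean (bigD1 x) //= eqxx big1 ?addr0 => [|y /negPf ->].
    by rewrite mulrCA mulVf ?mulr1.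
  by rewrite mulr0.
by move=> y; rewrite -mulr_sumr sum_character.
Qed.

Lemma parseval f g :
  mean (fun x => f x * g x) =
  \sum_(k < n) (coefc f k * coefc g k + coefs f k * coefs g k).
Proof.
rewrite (@eq_mean _ (fun x => \sum_(k < n)
   (coefc f k * (g x * cosn (k * x)) + coefs f k * (g x * sinn (k * x))))).
  by rewrite mean_sum; apply: eq_bigr => k _; rewrite meanD !meanZ.
move=> x; rewrite {1}(fourier_inversion f x) mulr_suml; apply: eq_bigr => k _.
ring.
Qed.

Lemma val_ZnD1 (x : 'Z_n) : (x + 1)%R = (x.+1 %% n)%N :> nat.
Proof.
case: n n_gt1 x => [|[|m]] // _ x.
by rewrite /= [(1 %% _)%N]modn_small // addn1.
Qed.

(** Addition in ['Z_n] reduces modulo [n], which changes the angle by full periods only. *)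
Lemma cosn_succ k (x : 'Z_n) :
  (cosn (k * (x + 1)%R) = cosn (k * x) * cosn k - sinn (k * x) * sinn k) *
  (sinn (k * (x + 1)%R) = sinn (k * x) * cosn k + cosn (k * x) * sinn k).
Proof.
have e : (k * x + k = k * (x + 1)%R + n * (k * (x.+1 %/ n)))%N.
  rewrite val_ZnD1 mulnCA -mulnDr -mulnSr.
  by congr (_ * _)%N; rewrite addnC [(n * _)%N]mulnC -divn_eq.
rewrite -cosnD -sinnD e cosnD sinnD cosn_period sinn_period.
by rewrite !mulr1 !mulr0 subr0 addr0.
Qed.

Lemma mean_shift f : mean (fun x => f (x + 1)) = mean f.
Proof.
rewrite /mean; congr (_ * _); rewrite [RHS](reindex_inj (addIr 1)).
by [].
Qed.

End Fourier.

(** * Spectrum of the walk and gaps between eigenvalues *)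

Section Spectrum.
Context {R : realType} (n : nat).
Hypothesis n_gt3 : (3 < n)%N.
Let n_gt1 : (1 < n)%N. Proof. exact: leq_trans n_gt3. Qed.
Implicit Types (f g : 'Z_n -> R) (j k : nat).

Local Notation cosn := (@cosn R n).
Local Notation sinn := (@sinn R n).
Local Notation K := (srw_kernel R n).

Lemma kernel_actE f x : kernel_act K f x = 2^-1 * (f (x + 1) + f (x - 1)).
Proof.
(* The two neighbours are distinct because 2 is nonzero in ['Z_n]. *)
have ne : (x - 1 == x + 1) = false.
  apply/negbTE; rewrite (inj_eq (addrI x)) eq_sym -subr_eq0 opprK.
  by apply/eqP => /(congr1 val); case: n n_gt3 => [|[|[|[|m]]]].
rewrite /kernel_act (bigD1 (x + 1)) //= (bigD1 (x - 1)) ?ne //=.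
rewrite big1 => [|y /andP[/negPf y1 /negPf y2]]; last first.
  by rewrite /srw_kernel y1 y2 mul0r.
by rewrite /srw_kernel !eqxx orbT /= addr0 mulrDr.
Qed.

(** A shift of the variable under the mean moves a step [+1] on one factor to a step [-1] on the
    other. *)
Lemma kernel_act_sym f g :
  mean (fun x => kernel_act K f x * g x) = mean (fun x => f x * kernel_act K g x).
Proof.
have e1 := mean_shift (fun x => f x * g (x - 1)).
have e2 := mean_shift (fun x => f (x - 1) * g x).
rewrite (@eq_mean _ _ _ (fun x => 2^-1 * (f (x + 1) * g (x + 1 - 1) + f (x - 1) * g x))).
  rewrite meanZ meanD e1 -e2 -meanD -meanZ; apply: eq_mean => x.
  by rewrite kernel_actE addrK; ring.
by move=> x; rewrite kernel_actE addrK; ring.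
Qed.

Lemma cosn_pred k (x : 'Z_n) :
  (cosn (k * (x - 1)%R) = cosn (k * x) * cosn k + sinn (k * x) * sinn k) *
  (sinn (k * (x - 1)%R) = sinn (k * x) * cosn k - cosn (k * x) * sinn k).
Proof.
have [] := @cosn_succ R n n_gt1 k (x - 1); rewrite subrK => -> ->.
have cs := @cosn_sinn_sqr R n k.
split; [rewrite -[LHS]mulr1|rewrite -[LHS]mulr1]; rewrite -cs; ring.
Qed.

Lemma kernel_act_character k x :
  (kernel_act K (fun x => cosn (k * x)) x = cosn k * cosn (k * x)) *
  (kernel_act K (fun x => sinn (k * x)) x = cosn k * sinn (k * x)).
Proof. by split; rewrite kernel_actE !cosn_pred !cosn_succ //; field. Qed.

Lemma mean_mulB f g u :
  mean (fun x => (f x - g x) * u x) = mean (fun x => f x * u x) - mean (fun x => g x * u x) :> R.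
Proof.
rewrite -[X in _ - X]mul1r -mulNr -meanZ -meanD; apply: eq_mean => x; ring.
Qed.

(** By self-adjointness [K] moves onto the characters, which are eigenfunctions with eigenvalue
    [cosn k]; Parseval does the rest. *)
Lemma dirichletE f :
  dirichlet K f = \sum_(k < n) (1 - cosn k) * (coefc f k ^+ 2 + coefs f k ^+ 2).
Proof.
rewrite /dirichlet /inner parseval //; apply: eq_bigr => k _.
rewrite /coefc /coefs !mean_mulB !kernel_act_sym.
rewrite (eq_mean (f := fun x => f x * kernel_act K (fun y => cosn (k * y)) x)
  (g := fun x => cosn k * (f x * cosn (k * x)))); last first.
  by move=> x; rewrite kernel_act_character; ring.
rewrite (eq_mean (f := fun x => f x * kernel_act K (fun y => sinn (k * y)) x)
  (g := fun x => cosn k * (f x * sinn (k * x)))); last first.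
  by move=> x; rewrite kernel_act_character; ring.
by rewrite !meanZ; ring.
Qed.

Lemma mean_cosn_sinn j : ~~ (n %| j)%N ->
  (mean (fun x : 'Z_n => cosn (j * x)) = 0) * (mean (fun x : 'Z_n => sinn (j * x)) = 0).
Proof.
move=> nj; have [c0 s0] := @sum_cosn_sinn R n n_gt1 j nj.
split; rewrite /mean.
  rewrite (sum_Zn n_gt1 (fun k => cosn (j * k))).
  by under eq_bigr do rewrite mulnC; rewrite c0 mulr0.
rewrite (sum_Zn n_gt1 (fun k => sinn (j * k))).
by under eq_bigr do rewrite mulnC; rewrite s0 mulr0.
Qed.

(** Any multiple of [n] is allowed, so that the reflection from [k] to [n - k] also applies to the
    angles [k * x]. *)
Lemma cosn_refl j k m : (j + k = n * m)%N ->
  (cosn j = cosn k) * (sinn j = - sinn k).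
Proof.
move=> e; have e' : k%:R = (n * m)%:R - j%:R :> R by rewrite -e natrD; ring.
have c1 := @cosn_period R n n_gt1 m; have s1 := @sinn_period R n n_gt1 m.
have -> : cosn k = cos ((n * m)%:R * (2 * pi / n%:R) - j%:R * (2 * pi / n%:R)).
  by rewrite -mulrBl -e'.
have -> : sinn k = sin ((n * m)%:R * (2 * pi / n%:R) - j%:R * (2 * pi / n%:R)).
  by rewrite -mulrBl -e'.
rewrite cosB sinB -!/(cosn _) -!/(sinn _) c1 s1.
by split; ring.
Qed.

(** Separates the constants and the first eigenspace (modes 1 and [n - 1]) from the modes of [h]. *)
Lemma sum_modes (F : nat -> R) :
  \sum_(k < n) F k = F 0%N + F 1%N + \sum_(2 <= k < n.-1) F k + F n.-1.
Proof.
rewrite -(big_mkord xpredT F) big_ltn ?(ltnW n_gt1) // big_ltn //.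
rewrite -{1}(@prednK n) ?(ltnW n_gt1) // big_nat_recr /=; last by lia.
by rewrite !addrA.
Qed.

(** With the half angle [pi / n], differences of eigenvalues become products of sines of known
    sign. *)
Let s m : R := sin (m%:R * (pi / n%:R)).

Lemma s_ge0 m : (m <= n)%N -> 0 <= s m.
Proof.
move=> mn; have n0 : 0 < n%:R :> R by rewrite ltr0n ltnW.
apply: sin_ge0_pi; rewrite mulr_ge0 ?ler0n ?divr_ge0 ?ler0n ?pi_ge0 //=.
by rewrite mulrA ler_pdivrMr // mulrC ler_pM2l ?pi_gt0 // ler_nat.
Qed.

Lemma s_gt0 m : (0 < m < n)%N -> 0 < s m.
Proof.
move=> /andP[m0 mn]; have n0 : 0 < n%:R :> R by rewrite ltr0n ltnW.
apply: sin_gt0_pi; rewrite mulr_gt0 ?ltr0n ?divr_gt0 ?pi_gt0 //=.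
by rewrite mulrA ltr_pdivrMr // mulrC ltr_pM2l ?pi_gt0 // ltr_nat.
Qed.

Lemma cosnB j k : (j <= k)%N -> cosn j - cosn k = 2 * s (k + j) * s (k - j).
Proof.
move=> jk; have n0 : n%:R != 0 :> R by rewrite pnatr_eq0 -lt0n ltnW.
rewrite /cosn /s natrB // natrD; pose a : R := k%:R * (pi / n%:R); pose b : R := j%:R * (pi / n%:R).
have -> : j%:R * (2 * pi / n%:R) = b *+ 2 by rewrite /b -mulr_natl; field.
have -> : k%:R * (2 * pi / n%:R) = a *+ 2 by rewrite /a -mulr_natl; field.
rewrite mulrBl (mulrDl k%:R) -/a -/b sinB sinD !cos_mulr2n.
have ca := cos2Dsin2 a; have cb := cos2Dsin2 b.
transitivity (2 * (cos b ^+ 2 - cos a ^+ 2)); first by ring.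
have -> : 2 * (sin a * cos b + cos a * sin b) * (sin a * cos b - cos a * sin b) =
  2 * (sin a ^+ 2 * cos b ^+ 2 - cos a ^+ 2 * sin b ^+ 2) by ring.
by rewrite !sin2cos2; ring.
Qed.

Lemma cosn_le2 k : (2 <= k < n.-1)%N -> cosn k <= cosn 2.
Proof.
(* The upper bound on [k] gives [k + 2 <= n], so both sines are nonnegative. *)
move=> /andP[k2 kn]; rewrite -subr_ge0 cosnB // !mulr_ge0 // s_ge0 //; lia.
Qed.

(** These are the dual weights in the pointwise bound [h_le]. The sum equals
    [2 - 1 / (2 cos^2 (pi / n))]. *)
Lemma sum_inv_gap :
  \sum_(2 <= k < n.-1) (1 - cosn 1) / (cosn 1 - cosn k) <= 3 / 2.
Proof.
pose c m : R := cos (m%:R * (pi / n%:R)).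
(* With T the cotangent, each term is a multiple of T k.-1 - T k.+1. *)
pose T k := c k / s k.
have s1 : 0 < s 1 by apply: s_gt0; rewrite n_gt1.
have c1 : 0 < c 1%N.
  have := @s_gt0 2; rewrite (leq_trans _ n_gt3) // => /(_ isT).
  have -> : s 2 = 2 * (c 1%N * s 1).
    by rewrite /s mulr_natl sin_mulr2n mul1r /c mul1r mulr_natl.
  by rewrite pmulr_rgt0 // pmulr_lgt0.
have s2E : s 2 = 2 * (c 1%N * s 1).
  by rewrite /s mulr_natl sin_mulr2n mul1r /c mul1r mulr_natl.
have TE k : (2 <= k < n.-1)%N ->
    (1 - cosn 1) / (cosn 1 - cosn k) = s 1 / (2 * c 1%N) * (T k.-1 - T k.+1).
  case: k => [//|j] /andP[j1 jn]; rewrite -{1}(@cosn0 R n) !cosnB // addn0 subn0 subn1 addn1 /=.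
  have sj : 0 < s j by apply: s_gt0; lia.
  have sj2 : 0 < s j.+2 by apply: s_gt0; lia.
  have e : c j * s j.+2 - c j.+2 * s j = s 2.
    rewrite /s (_ : 2 * (pi / n%:R) = j.+2%:R * (pi / n%:R) - j%:R * (pi / n%:R)).
      by rewrite sinB /c; ring.
    by rewrite -addn2 natrD; ring.
  have -> : T j - T j.+2 = s 2 / (s j * s j.+2).
    by rewrite -e /T; field; rewrite !gt_eqF.
  by rewrite s2E; field; rewrite !gt_eqF.
have cs_refl m : (m <= n)%N -> (c (n - m)%N = - c m) * (s (n - m) = s m).
  move=> mn; have e : n%:R * (pi / n%:R) = pi :> R.
    by rewrite mulrCA divff ?mulr1 // pnatr_eq0 -lt0n ltnW.
  rewrite /c /s natrB // mulrBl e sinB cosB sinpi cospi.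
  by split; ring.
have Trefl m : (m <= n)%N -> T (n - m)%N = - T m.
  by move=> mn; rewrite /T !cs_refl // mulNr.
rewrite (eq_big_nat _ _ TE) -mulr_sumr.
(* The telescoping has step two, so neighbouring cotangents are paired; [Trefl] then folds the upper
   boundary terms onto the lower ones. *)
pose U k := T k + T k.-1.
have -> : \sum_(2 <= k < n.-1) (T k.-1 - T k.+1) =
    - \sum_(2 <= k < n.-1) (U k.+1 - U k).
  by rewrite -sumrN; apply: eq_bigr => k _; rewrite /U /=; ring.
rewrite telescope_sumr /U; last by lia.
have -> : n.-1 = (n - 1)%N by rewrite subn1.
have -> : (n - 1).-1 = (n - 2)%N by lia.
rewrite !Trefl ?(ltnW n_gt1) // /T s2E.
have c2E : c 2%N = 2 * c 1%N ^+ 2 - 1.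
  by rewrite /c mulr_natl cos_mulr2n mul1r mulr_natl.
rewrite c2E /= (_ : _ * _ = 2 - c 1%N ^- 2 / 2); last first.
  by field; rewrite !gt_eqF.
have : 1 <= c 1%N ^- 2.
  by rewrite invf_ge1 ?exprn_gt0 // expr_le1 ?(ltW c1) //; apply: cos_le1.
lra.
Qed.

End Spectrum.

(** * Numerical inequalities *)

(** Here [x] and [y] stand for the L2-norms of [h] and [p], and [D] for the excess. The difference
    of the two sides is exactly [h1 + 3/4 h2 + h4]. *)
Lemma cubic_bound_numeric (R : realType) (r x y D : R) : 0 < r -> r ^+ 2 = 2 ->
  0 <= x -> 0 <= y -> x ^+ 2 + y ^+ 2 <= 1 -> 8 / 5 * x ^+ 2 <= D ->
  3 / 2 * r * (y ^+ 2 * x) + 3 * r * (y * x ^+ 2) + x * (D / 2 + 3 / 4 * x ^+ 2)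
  <= 3 / 4 * (x ^+ 2 + y ^+ 2) ^+ 2 + 3 * D.
Proof.
move=> r0 r2 x0 y0 xy1 xD.
have x1 : x <= 1 by nra.
have h1 : 0 <= (3 - x / 2) * (D - 8 / 5 * x ^+ 2) by apply: mulr_ge0; lra.
have h2 : 0 <= (y ^+ 2 - r * x) ^+ 2 by exact: sqr_ge0.
(* Subtracting [9/10 (1 - x^2 - y^2)] leaves the coefficients 12/5 of [y^2] and 33/20 of [x^2]; [a1]
   and [a2] complete these squares, with a positive constant left over. *)
have h3 : 0 <= 33 / 10 + 3 / 2 * y ^+ 2 + 3 / 4 * x ^+ 2 - 3 * r * y - 31 / 20 * x.
  have a1 : 0 <= (12 / 5 * y - 3 / 2 * r) ^+ 2 by exact: sqr_ge0.
  have a2 : 0 <= (33 / 20 * x - 31 / 40) ^+ 2 by exact: sqr_ge0.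
  nra.
have h4 := mulr_ge0 (sqr_ge0 x) h3.
have e : (y ^+ 2 - r * x) ^+ 2 = y ^+ 4 - 2 * (r * (y ^+ 2 * x)) + 2 * x ^+ 2.
  by rewrite -{2}r2; ring.
rewrite e in h2; lra.
Qed.

(** Cosine decreases on [[0, pi]], so [n = 5] is the worst case. There the vanishing sum of the
    fifth roots of unity gives [4 c^2 + 2 c = 1], which excludes [0 < c < 3/10]. *)
Lemma cosn1_ge (R : realType) (n : nat) : (4 < n)%N -> 3 / 10 <= @cosn R n 1.
Proof.
move=> n5; have n0 : 0 < n%:R :> R by rewrite ltr0n (leq_trans _ n5).
have le5 : @cosn R 5 1 <= @cosn R n 1.
  have pi0 := @pi_gt0 R.
  rewrite /cosn !mul1r; have h m : (4 < m)%N -> 2 * pi / m%:R \in `[0, (pi : R)].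
    move=> m5; have m0 : 0 < m%:R :> R by rewrite ltr0n (leq_trans _ m5).
    rewrite in_itv /= divr_ge0 ?mulr_ge0 ?ler0n ?pi_ge0 //= ler_pdivrMr // mulrC.
    by rewrite ler_pM2l // ler_nat (leq_trans _ m5).
  rewrite leNgt ltr_cos ?h // -leNgt.
  by rewrite ler_pM2l ?mulr_gt0 // lef_pV2 ?posrE // ler_nat.
apply: le_trans le5.
have c0 : 0 < @cosn R 5 1.
  have pi0 := @pi_gt0 R.
  apply: cos_gt0_pihalf; rewrite mul1r; apply/andP; split; lra.
have [+ _] := @sum_cosn_sinn R 5 isT 1 isT.
rewrite !big_ord_recr big_ord0 /= !muln1 add0r cosn0.
have [-> _] := @cosn_refl R 5 isT 4 1 1 erefl.
have [-> _] := @cosn_refl R 5 isT 3 2 1 erefl.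
rewrite (cosnD 5 1 1 : cosn 5 2 = _).
have := @cosn_sinn_sqr R 5 1; move: c0; set c := cosn _ _; set t := sinn _ _.
move=> c0 ct e; rewrite leNgt; apply/negP => c3.
have := mulr_gt0 c0 (_ : 0 < 3 / 10 - c); rewrite subr_gt0 => /(_ c3).
lra.
Qed.

(** * The third moment of a function of mean zero *)

Section CubicBound.
Context {R : realType} (n : nat).
Hypothesis n_gt3 : (3 < n)%N.
Let n_gt1 : (1 < n)%N. Proof. exact: leq_trans n_gt3. Qed.
Variable g : 'Z_n -> R.
Hypothesis mean_g : mean g = 0.

Local Notation cosn := (@cosn R n).
Local Notation sinn := (@sinn R n).
Local Notation K := (srw_kernel R n).

Let a := coefc g.
Let b := coefs g.
Let c k := a k ^+ 2 + b k ^+ 2.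
(* The modes 1 and n - 1 contribute equally, hence the factor 2. *)
Let p (x : 'Z_n) := 2 * (a 1%N * cosn x + b 1%N * sinn x).
Let h x := g x - p x.
(** [P] and [Q] are the real and imaginary parts of [(a 1 + i b 1)^2], the amplitude of mode 2 in
    [p^2]. *)
Let P := a 1%N ^+ 2 - b 1%N ^+ 2.
Let Q := 2 * a 1%N * b 1%N.
Let D := dirichlet K g / (1 - cosn 1) - mean (fun x => g x ^+ 2).

Let coef_last k : (0 < k < n)%N -> (a (n - k) = a k) * (b (n - k) = - b k).
Proof.
move=> /andP[k0 kn].
have e (x : 'Z_n) : ((n - k) * x + k * x = n * x)%N by rewrite -mulnDl subnK // ltnW.
split.
  by apply: eq_mean => x; have [-> _] := @cosn_refl R n n_gt3 _ _ _ (e x).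
rewrite -mulN1r -meanZ.
by apply: eq_mean => x; have [_ ->] := @cosn_refl R n n_gt3 _ _ _ (e x); ring.
Qed.

Let b0 : b 0 = 0.
Proof.
rewrite /b /coefs (eq_mean (g := fun _ => 0)) ?mean_cst // => x.
by rewrite mul0n sinn0 mulr0.
Qed.

Let a0 : a 0 = 0.
Proof.
rewrite -mean_g; apply: eq_mean => x.
by rewrite mul0n cosn0 mulr1.
Qed.

Let c_last : c n.-1 = c 1.
Proof. by rewrite /c -subn1 !coef_last ?n_gt1 // sqrrN. Qed.

Lemma mean_sqr_modes :
  mean (fun x => g x ^+ 2) = 2 * c 1 + \sum_(2 <= k < n.-1) c k.
Proof.
rewrite (eq_mean (g := fun x => g x * g x)); last by move=> x; rewrite expr2.
rewrite parseval // (eq_bigr (fun k : 'I_n => c k)); last first.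
  by move=> k _; rewrite /c !expr2.
rewrite (sum_modes n_gt3) c_last {1}/c a0 b0; ring.
Qed.

Lemma dirichlet_modes :
  dirichlet K g = (1 - cosn 1) * (2 * c 1) + \sum_(2 <= k < n.-1) (1 - cosn k) * c k.
Proof.
rewrite dirichletE // (sum_modes n_gt3 (fun k => (1 - cosn k) * c k)) c_last.
have -> : cosn n.-1 = cosn 1.
  by have [] // := @cosn_refl R n n_gt3 n.-1 1 1; lia.
rewrite /c a0 b0; ring.
Qed.

Lemma lam1_gt0 : 0 < 1 - cosn 1.
Proof. by rewrite subr_gt0 cosn_lt1 // dvdn1; lia. Qed.

(** Modes 1 and [n - 1] cancel, their eigenvalue for [I - K] being the spectral gap itself. *)
Lemma excess_modes : D = \sum_(2 <= k < n.-1) (cosn 1 - cosn k) / (1 - cosn 1) * c k.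
Proof.
have l0 := lam1_gt0.
rewrite /D dirichlet_modes mean_sqr_modes mulrDl mulr_suml [X in X + _ - _]mulrAC divff ?gt_eqF //.
rewrite mul1r opprD addrACA subrr add0r -sumrB; apply: eq_bigr => k _.
by field; rewrite gt_eqF.
Qed.

Lemma h_modes x : h x = \sum_(2 <= k < n.-1) (a k * cosn (k * x) + b k * sinn (k * x)).
Proof.
rewrite /h {1}(fourier_inversion n_gt1 g x).
rewrite (sum_modes n_gt3 (fun k => a k * cosn (k * x) + b k * sinn (k * x))).
rewrite -subn1 !coef_last ?n_gt1 // a0 b0.
have e : ((n - 1) * x + 1 * x = n * x)%N by rewrite -mulnDl subnK // ltnW.
have [-> ->] := @cosn_refl R n n_gt3 _ _ _ e.
by rewrite /p mul1n; ring.
Qed.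

Let mean_char j : (0 < j < n)%N ->
  (mean (fun x : 'Z_n => cosn (j * x)) = 0) * (mean (fun x : 'Z_n => sinn (j * x)) = 0).
Proof.
move=> /andP[j0 jn]; apply: mean_cosn_sinn => //.
by apply/negP => /(dvdn_leq j0); rewrite leqNgt jn.
Qed.

Let mean_char1 :
  (mean (fun x : 'Z_n => cosn x) = 0) * (mean (fun x : 'Z_n => sinn x) = 0).
Proof.
have [|c1 s1] := @mean_char 1; first by rewrite n_gt1.
by split; [rewrite -[RHS]c1|rewrite -[RHS]s1]; apply: eq_mean => x; rewrite mul1n.
Qed.

Lemma mean_p : mean p = 0.
Proof. by rewrite meanZ meanD !meanZ !mean_char1; ring. Qed.

Lemma mean_h : mean h = 0.
Proof.
rewrite (eq_mean (g := fun x => g x + (-1) * p x)) => [|x]; last by rewrite mulN1r.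
by rewrite meanD meanZ mean_p mean_g; ring.
Qed.

Lemma sqr_p x : p x ^+ 2 = 2 * c 1 + 2 * (P * cosn (2 * x) + Q * sinn (2 * x)).
Proof.
rewrite /p /P /Q /c mul2n -addnn cosnD sinnD.
have := @cosn_sinn_sqr R n x; set u := cosn x; set v := sinn x => uv.
have -> : 2 * (a 1%N ^+ 2 + b 1%N ^+ 2) = 2 * (a 1%N ^+ 2 + b 1%N ^+ 2) * (u ^+ 2 + v ^+ 2).
  by rewrite uv mulr1.
ring.
Qed.

Lemma mean_sqr_p : mean (fun x => p x ^+ 2) = 2 * c 1.
Proof.
rewrite (eq_mean sqr_p) meanD mean_cst // meanZ meanD !meanZ.
by rewrite !mean_char ?(leq_trans _ n_gt3) //; ring.
Qed.

Lemma cube_p x : p x ^+ 3 = 2 * c 1 * p x +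
  2 * (a 1%N * P + b 1%N * Q) * cosn x + 2 * (a 1%N * Q - b 1%N * P) * sinn x +
  2 * (a 1%N * P - b 1%N * Q) * cosn (3 * x) + 2 * (a 1%N * Q + b 1%N * P) * sinn (3 * x).
Proof.
rewrite exprSr sqr_p.
have -> : (3 * x = 2 * x + x)%N by rewrite mulSn addnC.
have e1 : cosn (2 * x) * cosn x + sinn (2 * x) * sinn x = cosn x.
  by rewrite /cosn /sinn -cosB -mulrBl -natrB ?mul2n -?addnn ?addnK ?leq_addr.
have e2 : sinn (2 * x) * cosn x - cosn (2 * x) * sinn x = sinn x.
  by rewrite /cosn /sinn -sinB -mulrBl -natrB ?mul2n -?addnn ?addnK ?leq_addr.
rewrite mulrDl -!addrA; congr (_ + _).
(* The mode-1 terms are expanded as differences of the angles [2 x] and [x], so that both sides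
   become polynomials in the same sines and cosines. *)
rewrite -[X in _ = _ * X + _]e1 -[X in _ = _ + (_ * X + _)]e2 cosnD sinnD /p; ring.
Qed.

Lemma mean_cube_p : mean (fun x => p x ^+ 3) = 0.
Proof.
rewrite (eq_mean cube_p) !meanD (meanZ (2 * c 1) p) mean_p !meanZ !mean_char1 !mean_char ?n_gt3 //.
by ring.
Qed.

(** Expanding [(p + h)^3] as [-2 p^3 + 3 g p^2 + h^2 (3 p + h)] pairs [p^2] with [g] itself, which
    yields its mode-2 coefficients directly. *)
Lemma mean_cube_g : mean (fun x => g x ^+ 3) =
  6 * (P * a 2 + Q * b 2) + mean (fun x => h x ^+ 2 * (3 * p x + h x)).
Proof.
have e x : g x ^+ 3 = (-2) * p x ^+ 3 +
    (6 * c 1 * g x + 6 * (P * (g x * cosn (2 * x)) + Q * (g x * sinn (2 * x)))) +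
    h x ^+ 2 * (3 * p x + h x).
  transitivity ((-2) * p x ^+ 3 + 3 * g x * p x ^+ 2 + h x ^+ 2 * (3 * p x + h x)).
    by rewrite /h; ring.
  by rewrite sqr_p; ring.
rewrite (eq_mean e) !meanD !meanZ meanD !meanZ mean_cube_p mean_g.
by rewrite /a /b /coefc /coefs; ring.
Qed.

Lemma mean_sqr_h : mean (fun x => h x ^+ 2) = \sum_(2 <= k < n.-1) c k.
Proof.
have e x : h x ^+ 2 = g x ^+ 2 +
    ((-4) * (a 1%N * (g x * cosn x) + b 1%N * (g x * sinn x)) + p x ^+ 2).
  by rewrite /h /p; ring.
have ea : mean (fun x : 'Z_n => g x * cosn x) = a 1.
  by apply: eq_mean => x; rewrite mul1n.
have eb : mean (fun x : 'Z_n => g x * sinn x) = b 1.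
  by apply: eq_mean => x; rewrite mul1n.
rewrite (eq_mean e) !meanD !meanZ meanD !meanZ ea eb mean_sqr_p mean_sqr_modes.
by rewrite /c; ring.
Qed.

Let M := \sum_(2 <= k < n.-1) c k.

Let c_ge0 k : 0 <= c k. Proof. by rewrite addr_ge0 ?sqr_ge0. Qed.

Let M_ge0 : 0 <= M. Proof. by rewrite sumr_ge0. Qed.

(** Cauchy-Schwarz in the plane, with [P^2 + Q^2 = c 1 ^ 2]. *)
Lemma coupling_sqr : (P * a 2 + Q * b 2) ^+ 2 <= c 1 ^+ 2 * c 2.
Proof.
rewrite -subr_ge0.
have -> : c 1 ^+ 2 * c 2 - (P * a 2 + Q * b 2) ^+ 2 = (P * b 2 - Q * a 2) ^+ 2.
  by rewrite /c /P /Q; ring.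
exact: sqr_ge0.
Qed.

Lemma p_sqr_le x : p x ^+ 2 <= 4 * c 1.
Proof.
rewrite -subr_ge0; have := @cosn_sinn_sqr R n x.
rewrite /p /c; set u := cosn x; set v := sinn x => uv.
have -> : 4 * (a 1%N ^+ 2 + b 1%N ^+ 2) = 4 * (a 1%N ^+ 2 + b 1%N ^+ 2) * (u ^+ 2 + v ^+ 2).
  by rewrite uv mulr1.
have -> : 4 * (a 1%N ^+ 2 + b 1%N ^+ 2) * (u ^+ 2 + v ^+ 2) -
   (2 * (a 1%N * u + b 1%N * v)) ^+ 2 = (2 * (a 1%N * v - b 1%N * u)) ^+ 2 by ring.
exact: sqr_ge0.
Qed.

Lemma cubic_bound4 : n = 4%N ->
  mean (fun x => g x ^+ 3) <= 3 / 4 * mean (fun x => g x ^+ 2) ^+ 2 + 3 * D.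
Proof.
move=> n4.
have c4 : cosn 4 = 1 by have := @cosn_period R n n_gt1 1; rewrite muln1 {2}n4.
have c2lt : cosn 2 < 1 by apply: (cosn_lt1 n_gt1); rewrite n4.
have c2 : cosn 2 = -1.
  move: (cosnD n 2 2 : cosn 4 = _) (@cosn_sinn_sqr R n 2); rewrite c4 => e1 e2.
  have : (1 - cosn 2) * (1 + cosn 2) = 0 by move: e1 e2; lra.
  by move/eqP; rewrite mulf_eq0 => /orP[] /eqP; lra.
have c1 : cosn 1 = 0.
  move: (cosnD n 1 1 : cosn 2 = _) (@cosn_sinn_sqr R n 1); rewrite c2 => e1 e2.
  have /eqP : cosn 1 ^+ 2 = 0 by move: e1 e2; lra.
  by rewrite sqrf_eq0 => /eqP.
have mid (F : nat -> R) : \sum_(2 <= k < n.-1) F k = F 2 by rewrite n4 big_nat1.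
have DE : D = c 2 by rewrite excess_modes mid c1 c2; field.
have s2 (x : 'Z_n) : sinn (2 * x) = 0 /\ cosn (2 * x) ^+ 2 = 1.
  have := @cosn_period R n n_gt1 x; rewrite {2}n4 (_ : 4 * x = 2 * x + 2 * x)%N; last by lia.
  rewrite cosnD => e; have := @cosn_sinn_sqr R n (2 * x) => e2.
  have e3 : sinn (2 * x) ^+ 2 = 0 by move: e e2; lra.
  by split; [apply/eqP; rewrite -sqrf_eq0 e3|lra].
(* [cosn (2 * x)] is a sign, so [h^2] is constant and its product with [3 p + h] has mean zero. *)
have hE x : h x ^+ 2 = a 2 ^+ 2.
  rewrite h_modes mid; have [-> e] := s2 x.
  by rewrite mulr0 addr0 exprMn e mulr1.
have b2 : b 2 = 0.
  rewrite /b /coefs (eq_mean (g := fun _ => 0)) ?mean_cst // => x.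
  by have [-> _] := s2 x; rewrite mulr0.
rewrite mean_cube_g (eq_mean (g := fun x => a 2 ^+ 2 * (3 * p x + h x))); last first.
  by move=> x; rewrite hE.
rewrite meanZ meanD meanZ mean_p mean_h mean_sqr_modes mid DE /c b2.
(* The core of what remains is [6 c1 |a2| <= 3 c1^2 + 3 a2^2]. *)
have : 0 <= (2 * c 1 - 2 * `|a 2|) ^+ 2 by exact: sqr_ge0.
have a22 : `|a 2| ^+ 2 = a 2 ^+ 2 by exact: real_normK (num_real _).
have : 6 * (P * a 2) <= 6 * (c 1 * `|a 2|).
  rewrite ler_pM2l // (le_trans (ler_norm _)) // normrM ler_wpM2r //.
  by rewrite ler_norml /P /c; have := sqr_ge0 (a 1%N); have := sqr_ge0 (b 1%N); lra.
have := mulr_ge0 (c_ge0 1) (sqr_ge0 (a 2)); have := sqr_ge0 (a 2 ^+ 2).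
have := c_ge0 1; rewrite -/(c 1); move: a22; set z := c 1; set A := `|a 2|; set B := a 2.
move=> AB z0 h1 h2 h3 h4; rewrite -AB in h1 h2 *; nra.
Qed.

Section LargeCycle.
Hypothesis n_gt4 : (4 < n)%N.
Let q k := (cosn 1 - cosn k) / (1 - cosn 1).

(** Mode 2 is the worst, and there [q] equals [1 + 2 cosn 1]. For [n = 4] this would only be 1,
    hence the separate case. *)
Let q_ge k : (2 <= k < n.-1)%N -> 8 / 5 <= q k.
Proof.
move=> k2; have l0 := lam1_gt0; rewrite /q ler_pdivlMr //.
have := @cosn_le2 R n n_gt3 k k2; have := cosn1_ge R n_gt4.
move: (cosnD n 1 1 : cosn 2 = _) (@cosn_sinn_sqr R n 1).
set u := cosn 1; set v := sinn 1 => -> uv u3.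
nra.
Qed.

Let D_ge : 8 / 5 * M <= D.
Proof.
rewrite excess_modes mulr_sumr big_nat [X in _ <= X]big_nat.
by apply: ler_sum => k k2; rewrite ler_wpM2r // q_ge.
Qed.

(** Young's inequality with weight [q k] in each mode: the weighted squares add up to at most
    [D / 2], and the dual weights are bounded by [sum_inv_gap]. *)
Lemma h_le (y : R) x : y * h x <= D / 2 + 3 / 4 * y ^+ 2.
Proof.
have : \sum_(2 <= k < n.-1) (q k * c k / 2 + y ^+ 2 / 2 * ((1 - cosn 1) / (cosn 1 - cosn k)))
   <= D / 2 + 3 / 4 * y ^+ 2.
  rewrite big_split /= -mulr_suml -mulr_sumr -excess_modes lerD2l.
  have := ler_wpM2l (divr_ge0 (sqr_ge0 y) (ler0n R 2)) (@sum_inv_gap R n n_gt3); lra.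
apply: le_trans; rewrite h_modes mulr_sumr big_nat [X in _ <= X]big_nat.
apply: ler_sum => k k2; have q0 : 0 < q k by apply: lt_le_trans (q_ge k2); lra.
rewrite -[_ / (cosn 1 - _)]invf_div -/(q k); set z := _ + _.
have zc : z ^+ 2 <= c k.
  rewrite -subr_ge0; have := @cosn_sinn_sqr R n (k * x).
  rewrite /z /c; set u := cosn _; set v := sinn _ => uv.
  rewrite -[X in X - _]mulr1 -uv.
  have -> : (a k ^+ 2 + b k ^+ 2) * (u ^+ 2 + v ^+ 2) - (a k * u + b k * v) ^+ 2 =
    (a k * v - b k * u) ^+ 2 by ring.
  exact: sqr_ge0.
have h1 : 0 <= (q k * z - y) ^+ 2 / (2 * q k) by rewrite divr_ge0 ?sqr_ge0 // mulr_ge0 // ltW.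
have e : (q k * z - y) ^+ 2 / (2 * q k) = q k * z ^+ 2 / 2 - y * z + y ^+ 2 / 2 * (q k)^-1.
  by field; rewrite gt_eqF.
have h2 := ler_wpM2l (ltW q0) zc.
rewrite e in h1; lra.
Qed.

(** Modes 2 and [n - 2] are distinct for [n > 4] and contribute equally. *)
Let M_ge : 2 * c 2 <= M.
Proof.
rewrite /M big_ltn; last by lia.
have -> : n.-1 = (n - 2).+1 by lia.
rewrite big_nat_recr /=; last by lia.
have -> : c (n - 2) = c 2 by rewrite /c !coef_last ?sqrrN // (leq_trans _ n_gt3).
by rewrite mulr_natl mulr2n lerD2l lerDr sumr_ge0.
Qed.

Lemma cubic_bound5 : mean (fun x => g x ^+ 2) <= 1 ->
  mean (fun x => g x ^+ 3) <= 3 / 4 * mean (fun x => g x ^+ 2) ^+ 2 + 3 * D.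
Proof.
move=> g1; pose r : R := Num.sqrt 2; pose X := Num.sqrt M; pose Y := Num.sqrt (2 * c 1).
have r0 : 0 < r by rewrite sqrtr_gt0.
have r2 : r ^+ 2 = 2 by rewrite sqr_sqrtr.
have X0 : 0 <= X := sqrtr_ge0 _.
have Y0 : 0 <= Y := sqrtr_ge0 _.
have X2 : X ^+ 2 = M by rewrite sqr_sqrtr.
have Y2 : Y ^+ 2 = 2 * c 1 by rewrite sqr_sqrtr // mulr_ge0.
have gE : mean (fun x => g x ^+ 2) = X ^+ 2 + Y ^+ 2.
  by rewrite mean_sqr_modes X2 Y2 addrC.
rewrite gE in g1 *.
apply: le_trans (cubic_bound_numeric r0 r2 X0 Y0 g1 _); last by rewrite X2.
rewrite mean_cube_g -addrA lerD //.
  (* [c 1] is [Y^2 / 2] and [c 2] is at most [X^2 / 2], so the square is at most [Y^4 X^2 / 8]; this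
     is where [r / 4] comes from. *)
  have : P * a 2 + Q * b 2 <= r / 4 * (Y ^+ 2 * X).
    apply: le_trans (ler_norm _) _; rewrite -ler_sqr ?nnegrE ?normr_ge0 //; last first.
      by rewrite !mulr_ge0 ?sqr_ge0 // ?invr_ge0 // ltW.
    rewrite real_normK ?num_real // (le_trans coupling_sqr) //.
    have -> : (r / 4 * (Y ^+ 2 * X)) ^+ 2 = r ^+ 2 / 16 * (Y ^+ 2) ^+ 2 * X ^+ 2 by field.
    rewrite r2 X2 Y2.
    have := ler_wpM2l (sqr_ge0 (c 1)) M_ge; lra.
  lra.
have p_le x : p x <= r * Y.
  apply: le_trans (ler_norm _) _; rewrite -ler_sqr ?nnegrE ?normr_ge0 ?mulr_ge0 ?(ltW r0) //.
  rewrite real_normK ?num_real // (le_trans (p_sqr_le x)) // exprMn r2 Y2; lra.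
have mh : mean (fun x => h x ^+ 2) = X ^+ 2 by rewrite X2 mean_sqr_h.
(* [h_le] is used with [y = X] and then divided by [X], so [X = 0] is treated apart. *)
have [X_eq0|X_gt0] : X = 0 \/ 0 < X by move: X0; rewrite le_eqVlt => /predU1P[<-|]; [left|right].
  have h0 x : h x ^+ 2 = 0.
    move: mh; rewrite X_eq0 expr0n /= /mean => /eqP.
    rewrite mulf_eq0 invr_eq0 pnatr_eq0 (gtn_eqF (ltnW n_gt1)) /= => sum0.
    apply/eqP; move: sum0; rewrite psumr_eq0 => [/allP /(_ x)|y _]; last exact: sqr_ge0.
    by rewrite mem_index_enum => /(_ isT).
  rewrite (eq_mean (g := fun _ => 0)) => [|x]; last by rewrite h0 mul0r.
  by rewrite mean_cst // X_eq0 expr0n /= !mulr0 mul0r addr0.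
have H : mean (fun x => h x ^+ 2 * (3 * p x + h x)) <=
    mean (fun x => (3 * (r * Y) + (D / 2 + 3 / 4 * X ^+ 2) / X) * h x ^+ 2).
  apply: ler_mean => x; rewrite [X in _ <= X]mulrC ler_wpM2l ?sqr_ge0 //.
  rewrite lerD ?ler_wpM2l // ler_pdivlMr // mulrC; exact: h_le.
apply: le_trans H _; rewrite meanZ mh.
have -> : (3 * (r * Y) + (D / 2 + 3 / 4 * X ^+ 2) / X) * X ^+ 2 =
  3 * r * (Y * X ^+ 2) + X * (D / 2 + 3 / 4 * X ^+ 2).
  by field; rewrite gt_eqF.
exact: lexx.
Qed.

End LargeCycle.

Lemma cubic_bound : mean (fun x => g x ^+ 2) <= 1 ->
  mean (fun x => g x ^+ 3) <= 3 / 4 * mean (fun x => g x ^+ 2) ^+ 2 + 3 * D.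
Proof.
move=> g1; move: (n_gt3); rewrite leq_eqVlt => /predU1P[n4|n_gt4].
  exact: cubic_bound4.
exact: cubic_bound5.
Qed.

End CubicBound.

(** * The log-Sobolev inequality and its optimality *)

Section LogSobolev.
Context {R : realType} (n : nat).
Hypothesis n_gt3 : (3 < n)%N.
Let n_gt1 : (1 < n)%N. Proof. exact: leq_trans n_gt3. Qed.
Implicit Types (f g : 'Z_n -> R).

Local Notation cosn := (@cosn R n).
Local Notation sinn := (@sinn R n).
Local Notation K := (srw_kernel R n).

Lemma mean_kernel_act g : mean (kernel_act K g) = mean g.
Proof.
have := kernel_act_sym n_gt3 g (fun _ => 1).
rewrite (eq_mean (g := kernel_act K g)) => [->|x]; last by rewrite mulr1.
by apply: eq_mean => x; rewrite kernel_actE //; field.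
Qed.

(** [K] fixes constants, and the cross term [a * mean (g - K g)] vanishes. *)
Lemma dirichlet_affine (m a : R) g :
  dirichlet K (fun x => m * (a + g x)) = m ^+ 2 * dirichlet K g.
Proof.
rewrite /dirichlet /inner (eq_mean (g := fun x => m ^+ 2 * (a * (g x + (-1) * kernel_act K g x) +
   g x * (g x - kernel_act K g x)))).
  by rewrite meanZ meanD meanZ meanD meanZ mean_kernel_act; ring.
by move=> x; rewrite !kernel_actE //; field.
Qed.

Lemma norm2_sqE f : norm2_sq f = mean (fun x => f x ^+ 2).
Proof. by apply: eq_mean => x; rewrite real_normK ?num_real. Qed.

Lemma log_sobolev_le f : (forall x, 0 <= f x) ->
  entropy_sq f <= 2 / (1 - cosn 1) * dirichlet K f.
Proof.
move=> f0; have l0 := @lam1_gt0 R n n_gt3.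
have N_ge0 : 0 <= norm2_sq f.
  by rewrite -(@mean_cst R n n_gt1 0); apply: ler_mean => x; rewrite sqr_ge0.
move: N_ge0; rewrite le_eqVlt => /predU1P[N0|N0].
  have f_eq0 x : f x = 0.
    move/esym/eqP: N0; rewrite norm2_sqE /mean.
    rewrite mulf_eq0 invr_eq0 pnatr_eq0 (gtn_eqF (ltnW n_gt1)) /= => sum0.
    apply/eqP; rewrite -sqrf_eq0.
    move: sum0; rewrite psumr_eq0 => [/allP /(_ x)|y _]; last exact: sqr_ge0.
    by rewrite mem_index_enum => /(_ isT).
  rewrite /entropy_sq -N0 mul0r subr0 /dirichlet /inner.
  by rewrite !(eq_mean (g := fun _ => 0)) ?mean_cst ?mulr0 // => x; rewrite f_eq0 ?expr0n !mul0r.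
pose m := Num.sqrt (norm2_sq f).
have m0 : 0 < m by rewrite sqrtr_gt0.
have m2 : m ^+ 2 = norm2_sq f by rewrite sqr_sqrtr // ltW.
have mn0 : m != 0 by rewrite gt_eqF.
pose F x := f x / m.
have F0 x : 0 <= F x by rewrite divr_ge0 // ltW.
have fE x : f x = m * F x by rewrite /F; field.
pose a := mean F; pose g x := F x - a.
have mF2 : mean (fun x => F x ^+ 2) = 1.
  apply: (mulfI (expf_neq0 2 mn0)); rewrite mulr1 -meanZ [RHS]m2 norm2_sqE.
  by apply: eq_mean => x; rewrite fE; ring.
have mg : mean g = 0.
  by rewrite meanD (mean_cst n_gt1 (- a)) subrr.
have gE x : g x = F x - a by [].
clearbody g.
have mg2 : mean (fun x => g x ^+ 2) = 1 - a ^+ 2.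
  rewrite (eq_mean (g := fun x => F x ^+ 2 + ((- 2 * a) * F x + a ^+ 2))).
    by rewrite !meanD mean_cst // meanZ mF2 -/a; ring.
  by move=> x; rewrite gE; ring.
have mF3 : mean (fun x => F x ^+ 3) =
    a ^+ 3 + 3 * a * (1 - a ^+ 2) + mean (fun x => g x ^+ 3).
  rewrite (eq_mean (g := fun x => g x ^+ 3 + (3 * a * (g x ^+ 2) + (3 * a ^+ 2 * g x + a ^+ 3)))).
    by rewrite !meanD mean_cst // !meanZ mg2 mg; ring.
  by move=> x; rewrite gE; ring.
have a0 : 0 <= a.
  by rewrite -(@mean_cst R n n_gt1 0); apply: ler_mean.
have a1 : a <= 1.
  have : 0 <= mean (fun x => g x ^+ 2).
    by rewrite -(@mean_cst R n n_gt1 0); apply: ler_mean => x; rewrite sqr_ge0.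
  by rewrite mg2; nra.
have dE : dirichlet K f = m ^+ 2 * dirichlet K g.
  rewrite -(dirichlet_affine m a); congr dirichlet.
  by apply: boolp.funext => x; rewrite fE gE addrC subrK.
(* For [f = m F] the logarithm of [m^2] contributes [m^2 ln (m^2) F^2], whose mean cancels the norm
   term of the entropy. Zeros of [F] are split off because [lnM] needs positive factors. *)
have ent : entropy_sq f <= m ^+ 2 * (2 / 3 * mean (fun x => F x ^+ 3) + 4 / 3 - 2 * a).
  rewrite /entropy_sq lerBlDr -m2.
  apply: (@le_trans _ _ (mean (fun x =>
    m ^+ 2 * (2 / 3 * F x ^+ 3 + (F x ^+ 2 + ((-2) * F x + 1 / 3)))
     + m ^+ 2 * ln (m ^+ 2) * F x ^+ 2))).
    apply: ler_mean => x; rewrite fE.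
    have := F0 x; rewrite le_eqVlt => /predU1P[<-|Fx].
      rewrite !(mulr0, expr0n) /= !(mulr0, mul0r, add0r, addr0).
      by rewrite mulr_ge0 ?sqr_ge0.
    rewrite exprMn lnM ?posrE ?exprn_gt0 // (lnXn 2 Fx).
    have := ler_wpM2l (sqr_ge0 m) (sqr_ln_le (F0 x)); rewrite -mulr_natl; lra.
  rewrite meanD !meanZ !meanD mean_cst // !meanZ mF2 -/a.
  by rewrite le_eqVlt; apply/orP; left; apply/eqP; field.
apply: le_trans ent _; rewrite dE.
have mg1 : mean (fun x => g x ^+ 2) <= 1.
  by rewrite mg2; have := sqr_ge0 a; lra.
have := cubic_bound n_gt3 mg mg1; rewrite mF3 mg2.
set E := dirichlet _ _; set G := mean _ => GE.
have -> : 2 / (1 - cosn 1) * (m ^+ 2 * E) = m ^+ 2 * (2 * (E / (1 - cosn 1))) by ring.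
rewrite ler_wpM2l ?sqr_ge0 //.
(* One sixth of this product is the slack left after inserting the cubic bound. *)
have h : 0 <= (1 - a) ^+ 3 * (1 + 3 * a).
  by rewrite mulr_ge0 ?exprn_ge0 ?subr_ge0 //; lra.
lra.
Qed.

Lemma log_sobolev_optimal (C : R) : C < 2 / (1 - cosn 1) ->
  ~ (forall f, (forall x, 0 <= f x) -> entropy_sq f <= C * dirichlet K f).
Proof.
have l0 := @lam1_gt0 R n n_gt3; rewrite ltr_pdivlMr // -subr_gt0.
set d := _ - _ => d0 H.
(* The final contradiction needs [2/3 e + 5/6 e^2 < d], which follows from [e < 1] and [2 e < d]. *)
pose e := d / (2 * (1 + d)).
have d1 : 0 < 2 * (1 + d) by lra.
have e0 : 0 < e by rewrite divr_gt0.
have ed : 2 * e < d.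
  have -> : 2 * e = d / (1 + d) by rewrite /e; field; lra.
  by rewrite ltr_pdivrMr; [nra|lra].
have e1 : e < 1 by rewrite ltr_pdivrMr //; lra.
pose u (x : 'Z_n) := cosn (1 * x).
have mu : mean u = 0.
  by apply: (mean_cosn_sinn n_gt3 _).1; rewrite dvdn1; lia.
have mc2 : mean (fun x : 'Z_n => cosn (2 * x)) = 0.
  by apply: (mean_cosn_sinn n_gt3 _).1; apply/negP => /dvdn_leq; lia.
have mu2 : mean (fun x => u x ^+ 2) = 1 / 2.
  rewrite (eq_mean (g := fun x : 'Z_n => 2^-1 * cosn (2 * x) + 2^-1)).
    by rewrite meanD mean_cst // meanZ mc2; field.
  move=> x; rewrite /u mul1n mul2n -addnn cosnD.
  have := @cosn_sinn_sqr R n x; lra.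
have u1 x : `|u x| <= 1 by exact: cos_max.
(* The factor 1 gives [f] the shape required by [dirichlet_affine]. *)
pose f x := 1 * (1 + e * u x).
have f0 x : 0 < f x.
  rewrite /f mul1r; have := u1 x; rewrite ler_norml => /andP[ux _]; nra.
have fE x : f x = 1 + e * u x by rewrite /f mul1r.
have dE : dirichlet K f = e ^+ 2 * (1 - cosn 1) / 2.
  rewrite /f (dirichlet_affine 1 1 (fun x => e * u x)) expr1n mul1r.
  rewrite /dirichlet /inner (eq_mean (g := fun x => e ^+ 2 * (1 - cosn 1) * u x ^+ 2)).
    by rewrite meanZ mu2; field.
  move=> x; rewrite (_ : kernel_act K _ x = e * kernel_act K u x).
    by rewrite /u (kernel_act_character n_gt3 1 x).1; ring.
  by rewrite !kernel_actE //; field.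
have NE : norm2_sq f = 1 + e ^+ 2 / 2.
  rewrite norm2_sqE (eq_mean (g := fun x => 1 + (2 * e * u x + e ^+ 2 * u x ^+ 2))).
    by rewrite !meanD mean_cst // !meanZ mu mu2; field.
  by move=> x; rewrite fE; ring.
have := H f (fun x => ltW (f0 x)); rewrite dE /entropy_sq NE.
have lnN : ln (1 + e ^+ 2 / 2) <= e ^+ 2 / 2.
  by apply: le_ln1Dx; have := sqr_ge0 e; lra.
have ent : e ^+ 2 / 2 * (3 - 2 / 3 * e - e ^+ 2 / 3) <=
    mean (fun x => f x ^+ 2 * ln (f x ^+ 2)).
  have -> : e ^+ 2 / 2 * (3 - 2 / 3 * e - e ^+ 2 / 3) =
    mean (fun x => 2 * e * u x + e ^+ 2 * (3 - 2 / 3 * e - e ^+ 2 / 3) * u x ^+ 2).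
    by rewrite meanD !meanZ mu mu2; field.
  apply: ler_mean => x.
  have -> : f x ^+ 2 * ln (f x ^+ 2) = 2 * f x ^+ 2 * ln (f x) by rewrite lnXn //; ring.
  apply: le_trans (sqr_ln_ge (f0 x)); rewrite fE.
  (* With [s = e * u x], the lower bound is [2 s + 3 s^2 + 2/3 s^3 - 1/3 s^4]; since [|u x| <= 1],
     the last two terms are bounded below by multiples of [u x ^ 2]. *)
  have h1 : 0 <= e ^+ 3 * u x ^+ 2 * (1 + u x).
    apply: mulr_ge0; first by rewrite mulr_ge0 ?sqr_ge0 ?exprn_ge0 ?(ltW e0).
    by have := u1 x; rewrite ler_norml => /andP[]; lra.
  have h2 : 0 <= e ^+ 4 * u x ^+ 2 * (1 - u x ^+ 2).
    apply: mulr_ge0; first by rewrite mulr_ge0 ?sqr_ge0 ?exprn_ge0 ?(ltW e0).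
    by rewrite subr_ge0 -(real_normK (num_real (u x))) expr_le1.
  lra.
have lnN' := ler_wpM2l (_ : 0 <= 1 + e ^+ 2 / 2) lnN.
move=> Hf.
have : e ^+ 2 / 2 * (3 - 2 / 3 * e - e ^+ 2 / 3) - (1 + e ^+ 2 / 2) * (e ^+ 2 / 2) <=
    C * (e ^+ 2 * (1 - cosn 1) / 2).
  apply: le_trans Hf; rewrite lerB // lnN' //; have := sqr_ge0 e; lra.
have -> : C * (e ^+ 2 * (1 - cosn 1) / 2) = e ^+ 2 / 2 * (2 - d) by rewrite /d; ring.
have -> : e ^+ 2 / 2 * (3 - 2 / 3 * e - e ^+ 2 / 3) - (1 + e ^+ 2 / 2) * (e ^+ 2 / 2) =
  e ^+ 2 / 2 * (2 - 2 / 3 * e - 5 / 6 * e ^+ 2) by field.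
rewrite ler_pM2l ?divr_gt0 ?exprn_gt0 //; nra.
Qed.

End LogSobolev.

Theorem corollary1p4 (R : realType) (n : nat) (hn : (4 <= n)%N) :
  (forall f : 'Z_n -> R, (forall x, 0 <= f x) ->
     entropy_sq f <=
       2 / (1 - cos (2 * pi / n%:R)) * dirichlet (srw_kernel R n) f)
  /\
  (forall C : R, C < 2 / (1 - cos (2 * pi / n%:R)) ->
     ~ (forall f : 'Z_n -> R, (forall x, 0 <= f x) ->
          entropy_sq f <= C * dirichlet (srw_kernel R n) f)).
Proof.
(* The angle takes the form [1 * _] that [cosn 1] unfolds to. *)
rewrite -[2 * pi / _]mul1r; split.
  exact: log_sobolev_le.
exact: log_sobolev_optimal.
Qed.
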